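(* For every integer $t\ge 2$ there exists a sequence of finite hypergraphs $(H_i)_{i\in\mathbb{N}}$ such that $\chi_{CF}(H_i)=2$ for all $i$ and $\lim_{i\to+\infty}\chi^t_{CF}(H_i)=+\infty$.
   Context: A hypergraph $H=(V,\mathcal{E})$ has finite vertex set $V$ and $\mathcal{E}\subseteq 2^V$. A conflict-free (CF) colouring of $H$ is a colouring $\varphi$ of $V$ such that every nonempty $h\in\mathcal{E}$ contains a vertex $x$ with $\varphi(y)\neq\varphi(x)$ for all $y\in h\setminus\{x\}$; $\chi_{CF}(H)$ is the least number of colours in such a colouring. For $t\in\mathbb{N}$, a $t$-subset-CF-colouring with $k$ colours is a function $\varphi$ from the $t$-element subsets of $V$ to a $k$-element set such that every $h\in\mathcal{E}$ with $|h|>t$ contains a $t$-subset $s\subseteq h$ whose colour differs from the colours of all other $t$-subsets of $h$; $\chi^t_{CF}(H)$ is the least such $k$. *)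

(* Defs.v *)
From mathcomp Require Import all_boot.
Set Implicit Arguments.
Unset Strict Implicit.
Unset Printing Implicit Defensive.

Record hypergraph := Hypergraph {
  vertex : finType;
  edges : {set {set vertex}}
}.

Definition CF_colouring (H : hypergraph) (k : nat)
    (phi : {ffun vertex H -> 'I_k}) : bool :=
  [forall h in edges H, (h != set0) ==>
    [exists x in h, [forall y in h :\ x, phi y != phi x]]].

Definition CF_colourable (H : hypergraph) (k : nat) : bool :=
  [exists phi : {ffun vertex H -> 'I_k}, CF_colouring phi].

Lemma CF_colourable_ex (H : hypergraph) : exists k, CF_colourable H k.
Proof.
exists #|vertex H|; apply/existsP; exists [ffun x => enum_rank x].
apply/forall_inP=> h _; apply/implyP=> /set0Pn [x xh].
apply/exists_inP; exists x => //; apply/forall_inP=> y.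
by rewrite !inE !ffunE (inj_eq enum_rank_inj) => /andP [].
Qed.

Definition chi_CF (H : hypergraph) : nat := ex_minn (CF_colourable_ex H).

(* Colourings are defined on the subtype of t-subsets only, so that a hypergraph
   with no t-subset is colourable with 0 colours. *)
Definition tsubset (t : nat) (H : hypergraph) : finType :=
  {s : {set vertex H} | #|s| == t}.

Definition tCF_colouring (t : nat) (H : hypergraph) (k : nat)
    (phi : {ffun tsubset t H -> 'I_k}) : bool :=
  [forall h in edges H, (t < #|h|) ==>
    [exists s : tsubset t H, (val s \subset h) &&
      [forall s' : tsubset t H,
        (val s' \subset h) && (s' != s) ==> (phi s' != phi s)]]].

Definition tCF_colourable (t : nat) (H : hypergraph) (k : nat) : bool :=
  [exists phi : {ffun tsubset t H -> 'I_k}, tCF_colouring phi].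

Lemma tCF_colourable_ex (t : nat) (H : hypergraph) :
  exists k, tCF_colourable t H k.
Proof.
exists #|tsubset t H|; apply/existsP; exists [ffun s => enum_rank s].
apply/forall_inP=> h _; apply/implyP=> th.
have : 0 < #|[set A : {set vertex H} | A \subset h & #|A| == t]|.
  by rewrite cards_draws bin_gt0 ltnW.
case/card_gt0P=> A; rewrite inE => /andP [Ah cA].
apply/existsP; exists (exist _ A cA : tsubset t H); rewrite Ah /=.
apply/forallP=> s'; apply/implyP=> /andP [_ ne].
by rewrite !ffunE (inj_eq enum_rank_inj).
Qed.

Definition chi_tCF (t : nat) (H : hypergraph) : nat :=
  ex_minn (tCF_colourable_ex t H).

(* Main.v *)
(** Fix a vertex [a] and take as edges all sets of size t+2 containing [a].
    Giving [a] a colour of its own yields a conflict-free 2-colouring.  For a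
    k-colouring of the t-subsets of a large vertex set, Ramsey's theorem, applied
    to the t-subsets avoiding [a] and then to the (t-1)-sets [B] coloured by
    [a |: B], gives an edge [a |: S] in which the colour of a t-subset depends
    only on whether it contains [a].  As 0 < t-1 and t < #|S|, both kinds of
    t-subsets occur at least twice, so no colour is unique in this edge. *)
Require Import Defs.
From mathcomp Require Import all_boot.
From mathcomp Require Import filter.
Set Implicit Arguments.
Unset Strict Implicit.
Unset Printing Implicit Defensive.
Local Open Scope classical_set_scope.

Lemma exists_subset_card (T : finType) (X : {set T}) (m : nat) :
  m <= #|X| -> exists2 S : {set T}, S \subset X & #|S| = m.
Proof.
move=> mX.
have : 0 < #|[set A : {set T} | A \subset X & #|A| == m]|.
  by rewrite cards_draws bin_gt0.
by case/card_gt0P=> A; rewrite inE => /andP [AX /eqP cA]; exists A.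
Qed.

Definition homogeneous (T : finType) (C : Type) (r : nat) (f : {set T} -> C)
    (S : {set T}) (c : C) : Prop :=
  forall A : {set T}, A \subset S -> #|A| = r -> f A = c.

(* The induction on the sum of the target sizes [m c] decreases the target of a
   single colour at each step. *)
Lemma ramsey_step (r k : nat) :
  (forall m, {N | forall (T : finType) (X : {set T}) (f : {set T} -> 'I_k),
     N <= #|X| -> exists (S : {set T}) c,
       [/\ S \subset X, #|S| = m & homogeneous r f S c]}) ->
  forall n, {N | forall (T : finType) (X : {set T}) (f : {set T} -> 'I_k)
      (m : 'I_k -> nat), \sum_c m c = n -> N <= #|X| -> exists (S : {set T}) c,
       [/\ S \subset X, #|S| = m c & homogeneous r.+1 f S c]}.
Proof.
move=> ramsey_r.
(* A target 0 is met by the empty set, which has no subset of size [r.+1]. *)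
have empty (T : finType) (X : {set T}) (f : {set T} -> 'I_k) (m : 'I_k -> nat) c :
    m c = 0 -> exists (S : {set T}) c,
    [/\ S \subset X, #|S| = m c & homogeneous r.+1 f S c].
  move=> mc0; exists set0, c; rewrite sub0set cards0 mc0; split=> // A.
  by rewrite subset0 => /eqP ->; rewrite cards0.
elim=> [|n [N IHn]].
  exists 0 => T X f m /eqP; rewrite sum_nat_eq0 => /forallP m0 _.
  (* All targets vanish here; [f set0] only supplies some colour. *)
  by apply: (empty _ _ _ _ (f set0)); apply/eqP; apply: m0.
have [M ramseyM] := ramsey_r N; exists M.+1 => T X f m sum_m leX.
have /card_gt0P [x xX] : 0 < #|X| by apply: leq_trans leX.
have leX' : M <= #|X :\ x| by move: leX; rewrite (cardsD1 x X) xX.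
(* Every [r.+1]-set formed by [x] and [r] points of [Y] now has colour [c]. So a [c]-homogeneous
   subset of [Y] may be extended by [x], and inside [Y] the target for [c] can be lowered by one. *)
have [Y [c [YX cY homY]]] := ramseyM T (X :\ x) (fun A => f (x |: A)) leX'.
have [/empty|mc_gt0] := posnP (m c); first exact.
pose m' d := m d - (d == c).
have sum_m' : \sum_d m' d = n.
  move: sum_m; rewrite (bigD1 c) //= => sum_m; rewrite (bigD1 c) //= /m' eqxx.
  rewrite (eq_bigr m) => [|d /negPf ->]; last by rewrite subn0.
  by case: (m c) mc_gt0 sum_m => // p _; rewrite subn1 addSn => -[].
have leY : N <= #|Y| by rewrite cY.
have [S [d [SY cS homS]]] := IHn T Y f m' sum_m' leY.
have SX : S \subset X :\ x := subset_trans SY YX.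
have [dc|ndc] := eqVneq d c; last first.
  exists S, d; split=> //; last by rewrite cS /m' (negPf ndc) subn0.
  exact: subset_trans SX (subD1set _ _).
rewrite {d}dc in cS homS.
have xS : x \notin S by apply/negP => /(subsetP SX); rewrite !inE eqxx.
exists (x |: S), c; split.
- by rewrite subUset sub1set xX (subset_trans SX) // subD1set.
- by rewrite cardsU1 xS cS /m' eqxx add1n subn1 prednK.
move=> A AS cA; have [xA|xA] := boolP (x \in A).
  rewrite -(setD1K xA); apply: homY.
    by rewrite (subset_trans _ SY) // subDset.
  by move: cA; rewrite (cardsD1 x A) xA add1n => -[].
apply: homS => //; apply/subsetP => y yA.
by have := subsetP AS y yA; rewrite !inE => /orP [/eqP yx|//]; rewrite -yx yA in xA.
Qed.

Theorem ramsey (r k m : nat) :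
  {N | forall (T : finType) (X : {set T}) (f : {set T} -> 'I_k),
     N <= #|X| -> exists (S : {set T}) c,
       [/\ S \subset X, #|S| = m & homogeneous r f S c]}.
Proof.
elim: r m => [|r IHr] m.
  exists m => T X f /exists_subset_card [S SX cS]; exists S, (f set0).
  by split=> // A _ /eqP; rewrite cards_eq0 => /eqP ->.
have [N ramseyN] := ramsey_step IHr (\sum_(c < k) m).
by exists N => T X f leX; apply: (ramseyN T X f (fun=> m)).
Qed.

(** Exchange one element of [B] for an element of [S] outside [B]. *)
Lemma exists_other_subset (T : finType) (S B : {set T}) :
  B \subset S -> 0 < #|B| < #|S| ->
  exists B' : {set T}, [/\ B' \subset S, #|B'| = #|B| & B' != B].
Proof.
move=> BS /andP [/card_gt0P [x xB] cBS].
have /set0Pn [y] : S :\: B != set0.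
  by rewrite setD_eq0; apply/negP => /subset_leq_card; rewrite leqNgt cBS.
rewrite inE => /andP [yB yS]; exists (y |: B :\ x); split.
- by rewrite subUset sub1set yS (subset_trans _ BS) // subD1set.
- by rewrite cardsU1 !inE (negPf yB) andbF (cardsD1 x B) xB.
- by apply: contraNneq yB => <-; rewrite setU11.
Qed.

(** [None] is the distinguished vertex. An edge has [t.+1] further vertices, the least number that
    leaves two [t]-subsets avoiding [None]. *)
Definition star (n t : nat) : hypergraph :=
  @Hypergraph (option 'I_n)
    [set h : {set option 'I_n} | (None \in h) && (#|h| == t.+2)].

Lemma star_CF_2colourable (n t : nat) : CF_colourable (star n t) 2.
Proof.
apply/existsP; exists [ffun x : vertex (star n t) => inord (x == None :> option _)].
apply/forall_inP=> h; rewrite inE => /andP [Nh _]; apply/implyP=> _.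
apply/exists_inP; exists None => //; apply/forall_inP=> y.
rewrite !inE !ffunE eqxx => /andP [/negPf -> _].
by rewrite -val_eqE /= !inordK.
Qed.

(** The bound [t < n] guarantees an edge; having at least two vertices, it rules out a single
    colour. *)
Lemma chi_CF_star (n t : nat) : t < n -> chi_CF (star n t) = 2.
Proof.
move=> tn; rewrite /chi_CF; case: ex_minnP => k /existsP [phi col] min_k.
apply/eqP; rewrite eqn_leq min_k ?star_CF_2colourable //= ltnNge.
apply/negP=> k1.
have [|S SN cS] := @exists_subset_card _ [set~ None : option 'I_n] t.+1.
  by rewrite cardsC1 card_option card_ord.
have NS : None \notin S.
  by apply/negP => /(subsetP SN); rewrite !inE eqxx.
have hE : (None |: S : {set vertex (star n t)}) \in edges (star n t).
  by rewrite inE setU11 cardsU1 NS cS eqxx.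
have := forall_inP col _ hE.
have -> /= : None |: S != set0 by apply/set0Pn; exists None; rewrite setU11.
case/exists_inP=> x xh /forall_inP unique_x.
have /card_gt0P [y yh] : 0 < #|(None |: S) :\ x|.
  by have := cardsD1 x (None |: S); rewrite xh cardsU1 NS cS !add1n => -[<-].
have eq0 (i : 'I_k) : i = 0 :> nat.
  by apply/eqP; rewrite -leqn0 -ltnS (leq_trans (ltn_ord i)).
by have := unique_x y yh; rewrite -val_eqE /= !eq0.
Qed.

Lemma star_not_tCF_colourable (t k : nat) : 2 <= t ->
  {N | forall n, N <= n ->
    forall c, c <= k -> ~~ tCF_colourable t (star n t) c}.
Proof.
move=> t2.
(* [M] serves the second application of Ramsey, so it is the target size of the first. With [k.+1]
   colours both bounds are fixed before [c], and [inord] preserves all colours below [c]. *)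
have [M ramseyM] := ramsey t.-1 k.+1 t.+1.
have [N ramseyN] := ramsey t k.+1 M.
exists N => n Nn c ck; apply/existsP => -[phi /forall_inP col].
pose V := option 'I_n.
pose f (A : {set V}) : 'I_k.+1 :=
  (* The default [ord0] is taken only on sets whose size is not [t]. *)
  if insub A is Some s then inord (phi s) else ord0.
have fE (s : tsubset t (star n t)) : f (val s) = phi s :> nat.
  by rewrite /f valK inordK // ltnS (leq_trans _ ck) // ltnW.
have leN : N <= #|[set~ None : V]| by rewrite cardsC1 card_option card_ord.
have [Y [c1 [YN cY homY]]] := ramseyN V _ f leN.
have leM : M <= #|Y| by rewrite cY.
have [S [c2 [SY cS homS]]] := ramseyM V Y (fun B => f (None |: B)) leM.
have NS : None \notin S.
  by apply/negP => /(subsetP SY) /(subsetP YN); rewrite !inE eqxx.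
pose h : {set vertex (star n t)} := None |: S.
have ch : #|h| = t.+2 by rewrite cardsU1 NS cS.
have hE : h \in edges (star n t) by rewrite inE setU11 ch eqxx.
have := col _ hE; rewrite ch ltnW //= => /existsP [s /andP [sh /forallP unique_s]].
have /eqP cs := valP s.
have [A [Ah cA As fA]] : exists A : {set V},
    [/\ A \subset h, #|A| = t, A != val s & f A = f (val s)].
  (* If [s] contains [None], exchange its other [t.-1] elements within [S], which requires
     [0 < t.-1]; otherwise exchange within [S] directly. Homogeneity keeps the colour in both
     cases. *)
  have [Nsv|Nsv] := boolP (None \in val s).
    have sS : val s :\ None \subset S by rewrite subDset.
    have csN : #|val s :\ None| = t.-1.
      by have /(congr1 predn) := cardsD1 None (val s); rewrite Nsv cs => ->.
    have [||B [BS cB Bs]] := @exists_other_subset _ S (val s :\ None) => //.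
      by rewrite csN cS ltnS leq_pred andbT -ltnS prednK // ltnW.
    have NB : None \notin B by apply: contra NS; apply: (subsetP BS).
    exists (None |: B); split.
    - exact: setUS.
    - by rewrite cardsU1 NB cB csN add1n prednK // ltnW.
    - by apply: contraNneq Bs => <-; rewrite setU1K.
    - by rewrite (homS B) ?cB // -(setD1K Nsv) (homS (val s :\ None)).
  have sS : val s \subset S.
    apply/subsetP=> y ys; have := subsetP sh y ys.
    by rewrite !inE => /orP [/eqP yN|//]; rewrite -yN ys in Nsv.
  have [|B [BS cB Bs]] := @exists_other_subset _ S (val s) sS.
    by rewrite cs cS ltnSn andbT ltnW.
  exists B; split=> //.
  - exact: subset_trans BS (subsetUr _ _).
  - by rewrite cB cs.
  - by rewrite !homY ?cB ?cs // (subset_trans _ SY).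
move/eqP in cA; pose s' : tsubset t (star n t) := exist _ A cA.
have := unique_s s'; rewrite Ah -val_eqE As /= -val_eqE /=.
by rewrite -!fE fA eqxx.
Qed.

Theorem theorem1p9 (t : nat) (ht : 2 <= t) :
  exists H : nat -> hypergraph,
    (forall i : nat, chi_CF (H i) = 2) /\
    chi_tCF t (H i) @[i --> \oo] --> \oo.
Proof.
(* The first summand defeats all palettes of at most [i] colours; adding [t.+1] secures
   [chi_CF_star]. *)
exists (fun i => star (sval (star_not_tCF_colourable i ht) + t.+1) t); split.
  by move=> i; apply: chi_CF_star; rewrite leq_addl.
move=> A [n _ nA]; exists n => // i /= ni; apply: nA => /=.
apply: (leq_trans ni); rewrite /chi_tCF; case: ex_minnP => c col _.
rewrite leqNgt; apply/negP => /ltnW ci; move: col; apply/negP.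
by case: star_not_tCF_colourable => N /= notcol; apply: notcol (leq_addr _ _) _ ci.
Qed.
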